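(* 1. Given a positive odd number $a$, the Collatz sequence of $a$ is equivalent to the Collatz sequence of an integer of the form $24t+21$ with $t\ge 0$ an integer. 2. Consider a number of the form $24t+21$ with $t\ge 0$ an integer, and let $p=2t+1$. If $t=0$, then the Collatz sequences of $24t+21$ and $1$ merge. If $t>0$, write $p=2^kn+1$, where $k\ge 1$ and $n$ is an odd number. If $k>2$, the Collatz sequences of $24t+21$ and $p$ merge. Otherwise, the Collatz sequences of $24t+21$ and $2p+1$ merge.
   Context: The Collatz sequence of a positive integer $A$ is $c_0=A$, and for $i\ge1$, $c_i=3c_{i-1}+1$ if $c_{i-1}$ is odd and $c_i=c_{i-1}/2$ if $c_{i-1}$ is even. The odd terms, in order, form an infinite subsequence indexed from $0$; the odd term $1$ is followed by $1,1,1,\dots$. Two Collatz sequences (of odd starting numbers) are equivalent if the second odd number occurring in each sequence is the same, i.e. the odd terms with index $1$ coincide. Two Collatz sequences merge if they become equal after a finite number of terms of each, i.e. sequences $(c_i)$ and $(c'_i)$ merge if there are $s,t\ge 0$ with $c_{s+i}=c'_{t+i}$ for all $i\ge 0$. *)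

(* Defs.v *)
From mathcomp Require Import all_boot.
From mathcomp Require Import zify.

Set Implicit Arguments.
Unset Strict Implicit.
Unset Printing Implicit Defensive.

Definition collatz_step (c : nat) : nat :=
  if odd c then 3 * c + 1 else c %/ 2.

Definition collatz (A i : nat) : nat := iter i collatz_step A.

(* [odd_term A j x]: the odd term with index [j] (indices starting at 0) of the
   Collatz sequence of [A] is [x], i.e. [x] is an odd term preceded by exactly
   [j] odd terms. For [A > 0] this is the graph of a total function of [j], see
   [odd_term_exists] and [odd_term_unique]. The sequence is not stopped at 1:
   1, 4, 2, 1, ... has odd terms 1, 1, 1, ... *)
Definition odd_term (A j x : nat) : Prop :=
  exists i : nat,
    [/\ odd (collatz A i),
        count (fun l => odd (collatz A l)) (iota 0 i) = j
      & collatz A i = x].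

Definition collatz_equivalent (A B : nat) : Prop :=
  exists x : nat, odd_term A 1 x /\ odd_term B 1 x.

Definition collatz_merge (A B : nat) : Prop :=
  exists s t : nat, forall i : nat, collatz A (s + i) = collatz B (t + i).

Lemma collatz_gt0 A i : 0 < A -> 0 < collatz A i.
Proof.
move=> A0; elim: i => [//|i IH]; rewrite /collatz iterS -/(collatz A i).
rewrite /collatz_step; case: ifP => odd_c; lia.
Qed.

Lemma next_odd A i : 0 < A ->
  exists2 d, odd (collatz A (i + d))
           & forall l, l < d -> ~~ odd (collatz A (i + l)).
Proof.
move=> A0; have [m] := ubnP (collatz A i).
elim: m i => [//|m IH] i lt_m.
case: (boolP (odd (collatz A i))) => odd_i; first by exists 0; rewrite ?addn0.
have c0 := collatz_gt0 i A0.
have stepE : collatz A i.+1 = collatz A i %/ 2.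
  by rewrite {1}/collatz iterS -/(collatz A i) /collatz_step (negbTE odd_i).
have [|d odd_d even_l] := IH i.+1; first by rewrite stepE; lia.
exists d.+1; first by rewrite addnS -addSn.
by case=> [|l] lt_l; rewrite ?addn0 // addnS -addSn even_l.
Qed.

Lemma odd_term_exists A j : 0 < A -> exists x, odd_term A j x.
Proof.
move=> A0; elim: j => [|j [_ [i [odd_i count_i _]]]].
  have [d odd_d even_l] := next_odd 0 A0.
  exists (collatz A d), d; split=> //.
  by apply/eqP; rewrite -leqn0 leqNgt -has_count; apply/hasPn => l;
    rewrite mem_iota => /even_l.
have [d odd_d even_l] := next_odd i.+1 A0.
exists (collatz A (i.+1 + d)), (i.+1 + d); split=> //.
rewrite iotaD count_cat -addn1 iotaD count_cat /= add0n odd_i count_i.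
suff -> : count (fun l => odd (collatz A l)) (iota (i + 1) d) = 0 by lia.
apply/eqP; rewrite -leqn0 leqNgt -has_count; apply/hasPn => l.
rewrite mem_iota => /andP[le_l lt_l].
by have -> : l = i.+1 + (l - i.+1) by [lia]; apply: even_l; lia.
Qed.

Lemma odd_term_unique A j x y : odd_term A j x -> odd_term A j y -> x = y.
Proof.
move=> [i [odd_i count_i <-]] [k [odd_k count_k <-]].
wlog le_ik : i k odd_i odd_k count_i count_k / i <= k.
  by move=> H; case: (leqP i k) => [/H|/ltnW/H]; [apply | move=> ->].
have [-> //|ne_ik] := eqVneq i k; exfalso.
have kE : k = i + (k - i).-1.+1 by lia.
move: count_k; rewrite kE iotaD count_cat /= add0n odd_i count_i; lia.
Qed.

(* Main.v *)
Require Import Defs.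
From mathcomp Require Import all_boot.
From mathcomp Require Import zify.

(** Since [3(4a+1)+1 = 4(3a+1)], replacing [a] by [4a+1] keeps the next odd term.
    For odd [a] each of [4a+1, 16a+5, 64a+21] is 5 mod 8, and they are
    [a+1, a+2, a] mod 3, so one of them is 21 mod 24.

    For the merging part, [24t+21 -> 8(9t+8)] reaches [9t+8], and so does
    [2p+1 = 4t+3 -> 12t+10 -> 6t+5 -> 18t+16], whatever [k] is.  If [k > 2] then
    [t = 4u]; halving [9t+8] twice gives [9u+2], which is also reached by
    [p = 8u+1 -> 24u+4 -> 12u+2 -> 6u+1 -> 18u+4]. *)

Lemma collatzS c i : collatz c i.+1 = collatz (collatz_step c) i.
Proof. exact: iterSr. Qed.

Lemma collatz_step_odd c : odd c -> collatz_step c = 3 * c + 1.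
Proof. by rewrite /collatz_step => ->. Qed.

Lemma collatz_step_double c : collatz_step (2 * c) = c.
Proof. by rewrite /collatz_step mul2n odd_double -mul2n mulKn. Qed.

Lemma collatz_double c i : collatz (2 * c) i.+1 = collatz c i.
Proof. by rewrite collatzS collatz_step_double. Qed.

Lemma collatz_double_pow c m i : collatz (2 ^ m * c) (m + i) = collatz c i.
Proof. by elim: m => [|m IHm]; rewrite ?mul1n // expnS -mulnA collatz_double. Qed.

Lemma collatz_odd c i : collatz (2 * c + 1) i.+2 = collatz (3 * c + 2) i.
Proof.
rewrite collatzS collatz_step_odd; last by lia.
by rewrite -(collatz_double (3 * c + 2)); congr collatz; lia.
Qed.

(** A single term determines all later ones, so one common value suffices. *)
Lemma collatz_merge_eq A B s t : collatz A s = collatz B t -> collatz_merge A B.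
Proof.
move=> eqAB; exists s, t => i; rewrite ![_ + i]addnC /collatz !iterD.
by congr iter.
Qed.

(** Putting [A] in front shifts the indices of the odd terms by one exactly when [A] is odd. *)
Lemma odd_term_step A j x :
  odd_term (collatz_step A) j x -> odd_term A (odd A + j) x.
Proof.
case=> i [odd_i <- <-]; exists i.+1; rewrite collatzS; split=> //.
rewrite -[iota 0 i.+1]/(0 :: iota 1 i) (iotaDl 1 0 i) /= count_map.
by congr addn; apply: eq_count => l; rewrite -collatzS.
Qed.

Lemma odd_term_double_pow A m j x : odd_term A j x -> odd_term (2 ^ m * A) j x.
Proof.
move=> termA; elim: m => [|m IHm]; first by rewrite mul1n.
have := @odd_term_step (2 ^ m.+1 * A) j x.
by rewrite expnS -mulnA collatz_step_double mul2n odd_double; apply.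
Qed.

(** The odd term of index 1 of an odd [a] is that of index 0 of [3 * a + 1], which a factor [2 ^ m]
    does not change. *)
Lemma collatz_equivalent_pow a b m : odd a -> odd b ->
  3 * b + 1 = 2 ^ m * (3 * a + 1) -> collatz_equivalent a b.
Proof.
move=> odd_a odd_b eq_ab.
have [|x term_x] := @odd_term_exists (3 * a + 1) 0; first by rewrite addn1.
exists x; split.
  by have := @odd_term_step a 0 x; rewrite collatz_step_odd // odd_a; apply.
have := @odd_term_step b 0 x; rewrite collatz_step_odd // odd_b eq_ab; apply.
exact: odd_term_double_pow.
Qed.

Lemma collatz_equivalent_mod24 a : odd a ->
  exists t, collatz_equivalent a (24 * t + 21).
Proof.
move=> odd_a.
have [r aE] : exists r, [\/ a = 6 * r + 1, a = 6 * r + 3 | a = 6 * r + 5].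
  exists (a %/ 6); have : [|| a == 6 * (a %/ 6) + 1, a == 6 * (a %/ 6) + 3
                            | a == 6 * (a %/ 6) + 5] by lia.
  by case/or3P=> /eqP ?; [constructor 1 | constructor 2 | constructor 3].
case: aE => aE.
(* The exponents 4, 6 and 2 stand for 16a+5, 64a+21 and 4a+1. *)
- by exists (4 * r); apply: (@collatz_equivalent_pow _ _ 4) => //; lia.
- by exists (16 * r + 8); apply: (@collatz_equivalent_pow _ _ 6) => //; lia.
by exists r; apply: (@collatz_equivalent_pow _ _ 2) => //; lia.
Qed.

Lemma collatz_24t21 t i : collatz (24 * t + 21) (4 + i) = collatz (9 * t + 8) i.
Proof.
have -> : 24 * t + 21 = 2 * (12 * t + 10) + 1 by lia.
rewrite collatz_odd -(collatz_double_pow (9 * t + 8) 2).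
by congr collatz; lia.
Qed.

Lemma collatz_merge_4t3 t : collatz_merge (24 * t + 21) (4 * t + 3).
Proof.
apply: (@collatz_merge_eq _ _ (4 + 0) 4); rewrite collatz_24t21.
have -> : 4 * t + 3 = 2 * (2 * t + 1) + 1 by lia.
(* The form [3 * c + 2] lets [collatz_odd] run backwards; both sides then start at 6t+5. *)
have -> : 9 * t + 8 = 3 * (3 * t + 2) + 2 by lia.
by rewrite collatz_odd -(collatz_odd (3 * t + 2)); congr collatz; lia.
Qed.

Lemma collatz_merge_8u1 u : collatz_merge (24 * (4 * u) + 21) (8 * u + 1).
Proof.
apply: (@collatz_merge_eq _ _ (4 + 2) 5); rewrite collatz_24t21.
have -> : 9 * (4 * u) + 8 = 2 ^ 2 * (9 * u + 2) by lia.
have -> : 8 * u + 1 = 2 * (4 * u) + 1 by lia.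
have -> : 9 * u + 2 = 3 * (3 * u) + 2 by lia.
(* Going backwards from 9u+2 through 6u+1, both sides meet at 12u+2. *)
rewrite (collatz_double_pow _ 2 0) collatz_odd -(collatz_odd (3 * u)).
rewrite -(collatz_double (2 * (3 * u) + 1)).
by congr collatz; lia.
Qed.

Theorem corollary4p1 :
  (forall a : nat, 0 < a -> odd a ->
     exists t : nat, collatz_equivalent a (24 * t + 21))
  /\
  (forall t p : nat, p = 2 * t + 1 ->
     (t = 0 -> collatz_merge (24 * t + 21) 1) /\
     (0 < t ->
        (exists k n : nat, [/\ 1 <= k, odd n & p = 2 ^ k * n + 1]) /\
        (forall k n : nat, 1 <= k -> odd n -> p = 2 ^ k * n + 1 ->
           (2 < k -> collatz_merge (24 * t + 21) p) /\
           (~ 2 < k -> collatz_merge (24 * t + 21) (2 * p + 1))))).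
Proof.
split=> [a _|t _ ->]; first exact: collatz_equivalent_mod24.
(* The seven steps are 21, 64, 32, 16, 8, 4, 2, 1. *)
split=> [->|t_gt0]; first exact: (@collatz_merge_eq _ _ 7 0).
split=> [|k n _ _ eq_p].
  (* Here [n] is the odd part of [t]; as p - 1 = 2t, the exponent is one more than that of [t]. *)
  have [n co2n tE] := @pfactor_coprime 2 t isT t_gt0.
  exists (logn 2 t).+1, n; split=> //; first by rewrite -coprime2n.
  by rewrite {1}tE expnS mulnAC mulnA.
split=> [k_gt2|_]; last first.
  have -> : 2 * (2 * t + 1) + 1 = 4 * t + 3 by lia.
  exact: collatz_merge_4t3.
have tE : t = 4 * (2 ^ (k - 3) * n).
  by move: eq_p; rewrite -{1}(subnK k_gt2) expnD; lia.
have -> : 2 * t + 1 = 8 * (2 ^ (k - 3) * n) + 1 by lia.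
by rewrite {1}tE; apply: collatz_merge_8u1.
Qed.
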